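(* Let $K\ge1$ be an integer and let $\mathbf{k}$ be a commutative ring with unit in which the integers $K+1,\dots,2K+1$ are invertible. Let $(A^\bullet,m_A,d_A)$ be a 2-dga over $\mathbf{k}$, let $(M^\bullet,m_M,d_M)$ be a 2-dgm over it, write $d=d_{End}$ for the differential on $End(M^\bullet)$, and let $\int:End(M^\bullet)\to\mathbf{k}$ be a linear functional of degree $2K+1$ (i.e. $\int b=0$ if $\bar b\ne 2K+1$) such that: 1. $\int$ is non-degenerate: if $\int ab=0$ for all $a$, then $b=0$; 2. $\int d(a)=0$ for all $a$; 3. $\int$ is cyclic: $\int a_1a_2\cdots a_n=(-1)^{\bar a_1(\bar a_2+\cdots+\bar a_n)}\int a_2\cdots a_na_1$ for homogeneous $a_1,\dots,a_n$. Then the Chern–Simons functional $$cs_{2,2K}(a)=2K\int\pi\bigl(\#^{-1}(a(d(a)+a^2)^K)\bigr)$$ is a Lagrangian for the $2K$-Maurer–Cartan equation, i.e. $a\in End^1(M^\bullet)$ is a critical point of $cs_{2,2K}$ if and only if $(d(a)+a^2)^K=0$.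
   Context: A 2-dga is a differential graded algebra: a $\mathbb{Z}$-graded associative $\mathbf{k}$-algebra $A^\bullet$ with a degree $1$ linear map $d_A$, $d_A(ab)=d_A(a)b+(-1)^{\bar a}a\,d_A(b)$, $d_A^2=0$. A 2-dgm over it is a graded $A^\bullet$-module $M^\bullet$ (associative action $A^k\otimes M^l\to M^{k+l}$) with a degree $1$ map $d_M$, $d_M(am)=d_A(a)m+(-1)^{\bar a}a\,d_M(m)$, $d_M^2=0$. $End^k(M)$ is the space of degree $k$ maps $f:M^\bullet\to M^\bullet$ that are $A^\bullet$-linear, $f(am)=(-1)^{\bar a\bar f}a f(m)$ (not required to commute with $d_M$); $End(M^\bullet)=\bigoplus_kEnd^k(M)$ with composition as product, and $d_{End}(f)=d_M\circ f-(-1)^{\bar f}f\circ d_M$. $\mathbf{k}\langle a,d(a)\rangle$ is the free associative $\mathbf{k}$-algebra on two symbols $a$ and $d(a)$; $\#$ is the linear endomorphism of it multiplying each monomial by its word length: $\#(a^{i_1}d(a)^{j_1}\cdots a^{i_k}d(a)^{j_k})=(i_1+\dots+i_k+j_1+\dots+j_k)\,a^{i_1}d(a)^{j_1}\cdots a^{i_k}d(a)^{j_k}$. The element $a(d(a)+a^2)^K$ is expanded in this free algebra, and $\#^{-1}$ divides each of its monomials by its word length (which lies between $K+1$ and $2K+1$). $\pi:\mathbf{k}\langle a,d(a)\rangle\to End(M^\bullet)$ is the canonical algebra map sending the symbols to the actual elements $a$ and $d_{End}(a)$. An element $a\in End^1(M^\bullet)$ is a critical point of $cs_{2,2K}$ if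 for all $b\in End^1(M^\bullet)$ the (formal) derivative $\frac{\partial}{\partial\varepsilon}cs_{2,2K}(a+b\varepsilon)|_{\varepsilon=0}$, i.e. the coefficient of $\varepsilon$ in the polynomial $cs_{2,2K}(a+b\varepsilon)$, is zero. *)

(* Defs.v *)
From HB Require Import structures.
From mathcomp Require Import all_boot all_order all_algebra finmap.
From mathcomp Require Import boolp functions.
From mathcomp Require Import monalg.

Set Implicit Arguments.
Unset Strict Implicit.
Unset Printing Implicit Defensive.

Import GRing.Theory.

Local Open Scope fset_scope.
Local Open Scope ring_scope.

(* -------------------------------------------------------------------- *)
(* gdeg G i v : v belongs to the degree i summand of V = \bigoplus_i V^i. *)
Record grading (k : pzRingType) (V : lmodType k) := Grading {
  gdeg : int -> V -> Prop;
  gdeg0 : forall i, gdeg i 0;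
  gdegP : forall i (c : k) u v, gdeg i u -> gdeg i v -> gdeg i (c *: u + v);
  gspan : forall v, exists (s : seq int) (h : int -> V),
    [/\ uniq s, forall i, gdeg i (h i) & v = \sum_(i <- s) h i];
  gdirect : forall (s : seq int) (h : int -> V), uniq s ->
    (forall i, gdeg i (h i)) -> \sum_(i <- s) h i = 0 ->
    forall i, i \in s -> h i = 0
}.

(* No unit is required of A, nor unitality of the action on M. *)
Record dga (k : comUnitRingType) := Dga {
  dga_car :> lmodType k;
  dga_gr : grading dga_car;
  dga_mul : dga_car -> dga_car -> dga_car;
  dga_d : {linear dga_car -> dga_car};
  dga_mul_linl : forall b, linear (dga_mul^~ b);
  dga_mul_linr : forall a, linear (dga_mul a);
  dga_mulA : associative dga_mul;
  dga_mul_deg : forall i j a b, gdeg dga_gr i a -> gdeg dga_gr j b ->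
    gdeg dga_gr (i + j) (dga_mul a b);
  dga_d_deg : forall i a, gdeg dga_gr i a -> gdeg dga_gr (i + 1) (dga_d a);
  dga_leibniz : forall i a b, gdeg dga_gr i a ->
    dga_d (dga_mul a b) =
      dga_mul (dga_d a) b + (-1) ^ i *: dga_mul a (dga_d b);
  dga_dd : forall a, dga_d (dga_d a) = 0
}.

Record dgm (k : comUnitRingType) (A : dga k) := Dgm {
  dgm_car :> lmodType k;
  dgm_gr : grading dgm_car;
  dgm_act : A -> dgm_car -> dgm_car;
  dgm_d : {linear dgm_car -> dgm_car};
  dgm_act_linl : forall m, linear (dgm_act^~ m);
  dgm_act_linr : forall a, linear (dgm_act a);
  dgm_actA : forall a b m, dgm_act a (dgm_act b m) = dgm_act (dga_mul a b) m;
  dgm_act_deg : forall i j a m, gdeg (dga_gr A) i a -> gdeg dgm_gr j m ->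
    gdeg dgm_gr (i + j) (dgm_act a m);
  dgm_d_deg : forall i m, gdeg dgm_gr i m -> gdeg dgm_gr (i + 1) (dgm_d m);
  dgm_leibniz : forall i a m, gdeg (dga_gr A) i a ->
    dgm_d (dgm_act a m) =
      dgm_act (dga_d A a) m + (-1) ^ i *: dgm_act a (dgm_d m);
  dgm_dd : forall m, dgm_d (dgm_d m) = 0
}.

(* -------------------------------------------------------------------- *)
Section LinearProp.
Variables (k : pzRingType) (U V : lmodType k) (f : U -> V) (lf : linear f).

Lemma lin0 : f 0 = 0.
Proof. by have := lf (-1) 0 0; rewrite scaler0 addr0 scaleN1r addNr. Qed.

Lemma linD : {morph f : u v / u + v}.
Proof. by move=> u v; rewrite -[u in LHS]scale1r lf scale1r. Qed.

Lemma linZ c u : f (c *: u) = c *: f u.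
Proof. by rewrite -[c *: u]addr0 lf lin0 addr0. Qed.

Lemma linB : {morph f : u v / u - v}.
Proof. by move=> u v; rewrite linD -[in LHS]scaleN1r linZ scaleN1r. Qed.

End LinearProp.

(* -------------------------------------------------------------------- *)
Section Grading.
Variables (k : pzRingType) (V : lmodType k) (G : grading V).

Lemma gdegD i u v : gdeg G i u -> gdeg G i v -> gdeg G i (u + v).
Proof. by move=> hu hv; rewrite -[u]scale1r; apply: gdegP. Qed.

Lemma gdegZ i (c : k) u : gdeg G i u -> gdeg G i (c *: u).
Proof. by move=> hu; rewrite -[_ *: _]addr0; apply: gdegP => //; apply: gdeg0. Qed.

Lemma gdegB i u v : gdeg G i u -> gdeg G i v -> gdeg G i (u - v).
Proof. by move=> hu hv; rewrite addrC -scaleN1r; apply: gdegP. Qed.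

Lemma gdeg_sum i (I : Type) (r : seq I) (P : pred I) (F : I -> V) :
  (forall j, P j -> gdeg G i (F j)) -> gdeg G i (\sum_(j <- r | P j) F j).
Proof. by move=> h; elim/big_ind: _ => // [|u v]; [apply: gdeg0|apply: gdegD]. Qed.

Lemma gdecP v : { sh : seq int * (int -> V) | [/\ uniq sh.1,
  forall i, gdeg G i (sh.2 i) & v = \sum_(i <- sh.1) sh.2 i] }.
Proof. by apply: cid; have [s [h hs]] := gspan G v; exists (s, h). Qed.

Definition gsupp v : seq int := (sval (gdecP v)).1.
Definition gcomp v : int -> V := (sval (gdecP v)).2.

Lemma gsupp_uniq v : uniq (gsupp v).
Proof. by rewrite /gsupp; case: (gdecP v) => ? []. Qed.

Lemma gcomp_deg v i : gdeg G i (gcomp v i).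
Proof. by rewrite /gcomp; case: (gdecP v) => ? []. Qed.

Lemma gcompE v : v = \sum_(i <- gsupp v) gcomp v i.
Proof. by rewrite /gsupp /gcomp; case: (gdecP v) => ? []. Qed.

Lemma gcomp_homog i v j : gdeg G i v ->
  (if j \in gsupp v then gcomp v j else 0) = (if j == i then v else 0).
Proof.
move=> hv; pose h j := (if j \in gsupp v then gcomp v j else 0)
  - (if j == i then v else 0).
have hd l : gdeg G l (h l).
  apply: gdegB; first by case: ifP => _; [apply: gcomp_deg|apply: gdeg0].
  by case: eqP => [->//|_]; apply: gdeg0.
pose s := undup [:: i, j & gsupp v].
have ext (P : pred int) (F : int -> V) r : uniq r -> r =i [pred l in s | P l] ->
    \sum_(l <- s) (if P l then F l else 0) = \sum_(l <- r) F l.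
  move=> ur er; rewrite -big_mkcond /= -big_filter; apply/perm_big/uniq_perm.
  - exact/filter_uniq/undup_uniq.
  - by [].
  - by move=> l; rewrite mem_filter er inE andbC.
apply/eqP; rewrite -subr_eq0; apply/eqP; rewrite -/(h j).
apply: (@gdirect _ _ G s h (undup_uniq _) hd); last first.
  by rewrite mem_undup !inE eqxx orbT.
rewrite sumrB (ext _ _ (gsupp v)) ?gsupp_uniq //; last first.
  by move=> l; rewrite !inE mem_undup !inE; case: (l \in gsupp v); rewrite ?orbT ?andbF.
rewrite (ext (pred1 i) (fun=> v) [:: i]) //; last first.
  by move=> l; rewrite !inE mem_undup !inE; case: (l == i); rewrite ?andbF.
by rewrite big_seq1 -gcompE subrr.
Qed.

Lemma gsum_homog (W : zmodType) (phi : int -> V -> W) i v :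
  (forall j, phi j 0 = 0) -> gdeg G i v ->
  \sum_(j <- gsupp v) phi j (gcomp v j) = phi i v.
Proof.
move=> phi0 hv; have := gcomp_homog _ hv => hj.
have [iv|iv] := boolP (i \in gsupp v).
  rewrite (big_rem i) //= -[X in _ + X]/(\sum_(j <- rem i (gsupp v)) _).
  rewrite big_seq big1 ?addr0.
    by have := hj i; rewrite iv eqxx => ->.
  move=> j; rewrite mem_rem_uniq ?gsupp_uniq // inE => /andP[/negbTE ji js].
  by have := hj j; rewrite js ji => ->; rewrite phi0.
have v0 : v = 0 by have := hj i; rewrite (negbTE iv) eqxx => ->.
rewrite v0 phi0 -v0 big_seq big1 // => j js.
by have := hj j; rewrite js => ->; rewrite v0 if_same phi0.
Qed.

End Grading.

(* -------------------------------------------------------------------- *)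
Section Endo.
Variables (k : comUnitRingType) (A : dga k) (M : dgm A).

Local Notation degA := (gdeg (dga_gr A)).
Local Notation degM := (gdeg (dgm_gr M)).

(* End^i(M). *)
Definition endo_deg (i : int) (f : M -> M) : Prop :=
  [/\ linear f,
      forall l m, degM l m -> degM (l + i) (f m)
    & forall j a m, degA j a ->
        f (dgm_act a m) = (-1) ^ (j * i) *: dgm_act a (f m)].

(* The internal sum of the End^i(M), which is direct inside M -> M: see
   endo_direct. *)
Definition is_endo (f : M -> M) : Prop := exists (s : seq int) (h : int -> M -> M),
  [/\ uniq s, forall i, endo_deg i (h i) & f = \sum_(i <- s) h i].

Definition endo_pred : {pred (M -> M)} := fun f => `[< is_endo f >].

Lemma endo_deg_lin i (c : k) f g :
  endo_deg i f -> endo_deg i g -> endo_deg i (c *: f + g).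
Proof.
move=> [lf df af] [lg dg ag]; split=> [x u v|l m hm|j a m ha].
- rewrite !fctE lf lg scalerDr addrACA !scalerA [c * x]mulrC -!scalerA.
  by rewrite [in RHS]scalerDr.
- by rewrite fctE; apply: gdegP; [apply: df|apply: dg].
- rewrite !fctE (af _ _ _ ha) (ag _ _ _ ha) (dgm_act_linr a).
  by rewrite scalerDr !scalerA mulrC.
Qed.

Lemma endo_deg0 i : endo_deg i 0.
Proof.
split=> [c u v|l m hm|j a m ha]; first 2 last.
- rewrite [LHS](_ : _ = 0) // [X in dgm_act a X](_ : _ = 0) //.
  by rewrite (lin0 (dgm_act_linr (d := M) a)) scaler0.
- by rewrite [LHS](_ : _ = 0) // [X in c *: X](_ : _ = 0) // scaler0 add0r.
- exact: gdeg0.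
Qed.

Lemma endo_degD i f g : endo_deg i f -> endo_deg i g -> endo_deg i (f + g).
Proof. by move=> hf hg; rewrite -[f]scale1r; apply: endo_deg_lin. Qed.

Lemma endo_deg1 : endo_deg 0 idfun.
Proof.
by split=> [x u v|l m hm|j a m ha] //=; rewrite ?addr0 ?mulr0 ?expr0z ?scale1r.
Qed.

Lemma endo_degM i j f g :
  endo_deg i f -> endo_deg j g -> endo_deg (i + j) (f \o g).
Proof.
move=> [lf df af] [lg dg ag]; split=> [x u v|l m hm|l a m ha] /=.
- by rewrite lg lf.
- by rewrite [i + j]addrC addrA; apply/df/dg.
- have um1 : (-1 : k) \is a GRing.unit by rewrite unitrN unitr1.
  by rewrite (ag _ _ _ ha) (linZ lf) (af _ _ _ ha) scalerA -(exprzDr um1) -mulrDr [j + i]addrC.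
Qed.


Lemma is_endo_add f g : is_endo f -> is_endo g -> is_endo (f + g).
Proof.
have ext (s u : seq int) (h : int -> M -> M) : uniq s -> uniq u ->
    {subset s <= u} ->
    \sum_(i <- s) h i = \sum_(i <- u) if i \in s then h i else 0.
  move=> us uu ssu; rewrite -big_mkcond /= -[RHS]big_filter.
  apply/perm_big/uniq_perm => //; first exact: filter_uniq.
  move=> i; rewrite mem_filter.
  by have [/ssu->|] := boolP (i \in s).
move=> [s [h [us hd ->]]] [t [h' [ut hd' ->]]].
exists (undup (s ++ t)), (fun i =>
  (if i \in s then h i else 0) + (if i \in t then h' i else 0)).
split=> [|i|]; first exact: undup_uniq.
  by apply: endo_degD; case: ifP => // _; apply: endo_deg0.
rewrite big_split /= -!ext ?undup_uniq //.
  by move=> i it; rewrite mem_undup mem_cat it orbT.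
by move=> i it; rewrite mem_undup mem_cat it.
Qed.

Lemma is_endo_deg i f : endo_deg i f -> is_endo f.
Proof.
move=> hf; exists [:: i], (fun j => if j == i then f else 0).
split=> // [j|]; last by rewrite big_seq1 eqxx.
by case: eqVneq => [->//|_]; apply: endo_deg0.
Qed.

Lemma is_endo_sum (s : seq int) (h : int -> M -> M) :
  (forall i, is_endo (h i)) -> is_endo (\sum_(i <- s) h i).
Proof.
move=> hh; elim/big_rec: _ => [|i f _]; first exact: (is_endo_deg (endo_deg0 0)).
exact: is_endo_add.
Qed.

Lemma is_endo_comp f g : is_endo f -> is_endo g -> is_endo (f \o g).
Proof.
move=> [s [h [us hd ->]]] [t [h' [ut hd' ->]]].
have -> : (\sum_(i <- s) h i) \o (\sum_(j <- t) h' j) =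
    \sum_(i <- s) \sum_(j <- t) (h i \o h' j).
  apply/funext => m; rewrite /= !fct_sumE; apply: eq_bigr => i _.
  rewrite !fct_sumE; case: (hd i) => li _ _.
  by rewrite (big_morph _ (linD li) (lin0 li)).
apply: is_endo_sum => i; apply: is_endo_sum => j.
exact: is_endo_deg (endo_degM (hd i) (hd' j)).
Qed.

Fact endo_submod : submod_closed endo_pred.
Proof.
split; first by rewrite unfold_in; apply/asboolP; exact: is_endo_deg (endo_deg0 0).
move=> c f g; rewrite !unfold_in => /asboolP[s [h [us hd ->]]] /asboolP hg; apply/asboolP.
apply: is_endo_add => //; rewrite scaler_sumr; apply: is_endo_sum => i.
apply: (@is_endo_deg i); rewrite -[_ *: _]addr0.
exact/endo_deg_lin/endo_deg0.
Qed.

Lemma endo_direct (s : seq int) (h : int -> M -> M) : uniq s ->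
  (forall i, endo_deg i (h i)) -> \sum_(i <- s) h i = 0 ->
  forall i, i \in s -> h i = 0.
Proof.
move=> us hd s0 i si; have hm l m : degM l m -> h i m = 0.
  move=> ml; rewrite -[i](addKr l) addrC.
  apply: (@gdirect _ _ (dgm_gr M) [seq l + j | j <- s] (fun j => h (j - l) m)).
  - by rewrite map_inj_uniq //; apply: addrI.
  - by move=> j; rewrite -[X in gdeg _ X](subrKC l); case: (hd (j - l)) => _ + _; apply.
  - rewrite big_map; have /(congr1 (fun f : M -> M => f m)) := s0.
    rewrite fct_sumE => e; rewrite -[RHS]e.
    by apply: eq_bigr => j _; rewrite addrC addKr.
  - by apply/mapP; exists i => //; rewrite addrC.
case: (hd i) => li _ _.
apply/funext => m; rewrite [m](gcompE (dgm_gr M)) (big_morph _ (linD li) (lin0 li)).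
by rewrite big1 // => l _; apply/hm/gcomp_deg.
Qed.


HB.instance Definition _ :=
  GRing.isSubSemiModClosed.Build k (M -> M) endo_pred endo_submod.

Record endo := Endo { endo_fun :> M -> M; _ : endo_fun \in endo_pred }.

HB.instance Definition _ := [isSub for endo_fun].
HB.instance Definition _ := [Choice of endo by <:].
HB.instance Definition _ := [SubChoice_isSubLmodule of endo by <:].

Lemma endoP (f : endo) : is_endo f.
Proof. by have := valP f; rewrite unfold_in => /asboolP. Qed.

Lemma is_endo_in f : is_endo f -> f \in endo_pred.
Proof. by move=> hf; rewrite unfold_in; apply/asboolP. Qed.

Lemma is_endo_linear f : is_endo f -> linear f.
Proof.
move=> [s [h [_ hd ->]]] c u v; rewrite !fct_sumE scaler_sumr -big_split /=.
by apply: eq_bigr => i _; case: (hd i) => + _ _; apply.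
Qed.

Definition endo1 : endo := Endo (is_endo_in (is_endo_deg endo_deg1)).

Definition endoM (f g : endo) : endo :=
  Endo (is_endo_in (is_endo_comp (endoP f) (endoP g))).

Fact endoA : associative endoM.
Proof. by move=> f g h; apply: val_inj. Qed.

Fact endo1M : left_id endo1 endoM.
Proof. by move=> f; apply: val_inj. Qed.

Fact endoM1 : right_id endo1 endoM.
Proof. by move=> f; apply: val_inj. Qed.

Fact endoDM : left_distributive endoM +%R.
Proof. by move=> f g h; apply: val_inj. Qed.

Fact endoMD : right_distributive endoM +%R.
Proof.
move=> f g h; apply: val_inj; apply/funext => m.
exact: (linD (is_endo_linear (endoP f))).
Qed.

HB.instance Definition _ :=
  GRing.Zmodule_isPzRing.Build endo endoA endo1M endoM1 endoDM endoMD.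

Fact endo_gspan (f : endo) : exists (s : seq int) (h : int -> endo),
  [/\ uniq s, forall i, endo_deg i (h i) & f = \sum_(i <- s) h i].
Proof.
have [s [h [us hd e]]] := endoP f.
exists s, (fun i => Endo (is_endo_in (is_endo_deg (hd i)))); split=> //.
by apply: val_inj; rewrite raddf_sum.
Qed.

Fact endo_gdirect (s : seq int) (h : int -> endo) : uniq s ->
  (forall i, endo_deg i (h i)) -> \sum_(i <- s) h i = 0 ->
  forall i, i \in s -> h i = 0.
Proof.
move=> us hd s0 i si; apply: val_inj.
apply: (endo_direct us hd) si.
by rewrite -[RHS](congr1 val s0) raddf_sum.
Qed.

Definition endo_gr : grading endo := @Grading k endo
  (fun i (f : endo) => endo_deg i f) endo_deg0
  (fun i c (f g : endo) => @endo_deg_lin i c f g) endo_gspan endo_gdirect.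

Definition d_comm (i : int) (f : M -> M) : M -> M :=
  (dgm_d M \o f) - (-1) ^ i *: (f \o dgm_d M).

Lemma d_comm_deg i f : endo_deg i f -> endo_deg (i + 1) (d_comm i f).
Proof.
move=> [lf df af]; split=> [c u v|l m hm|j a m ha]; rewrite /d_comm !fctE.
- rewrite lf !linearP lf !scalerDr scalerN !scalerA [c * _]mulrC opprD.
  by rewrite addrACA.
- apply: gdegB; first by rewrite addrA; apply/dgm_d_deg/df.
  by apply: gdegZ; rewrite [i + 1]addrC addrA; apply/df/dgm_d_deg.
- have um1 : (-1 : k) \is a GRing.unit by rewrite unitrN unitr1.
  rewrite (af _ _ _ ha) linearZ /= (dgm_leibniz _ ha) (dgm_leibniz _ ha).
  rewrite (linD lf) (linZ lf) (af _ _ _ (dga_d_deg ha)) (af _ _ _ ha).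
  rewrite (linB (dgm_act_linr (d := M) a)) (linZ (dgm_act_linr (d := M) a)).
  rewrite !scalerDr scalerN !scalerA -!(exprzDr um1) opprD addrACA.
  rewrite (_ : i + (j + 1) * i = j * i + (i + i)); last first.
    by rewrite mulrDl mul1r addrCA.
  rewrite (exprzDr um1 (j * i) (i + i)) (_ : (-1) ^ (i + i) = 1) ?mulr1; last first.
    by rewrite (exprzDr um1) -expNrz opprK exp1rz.
  rewrite subrr add0r mulrDr mulr1; congr (_ *: _ - _ *: _).
  by congr (_ ^ _); rewrite addrC [i + j]addrC addrA.
Qed.

Lemma dEnd_subproof (f : endo) :
  \sum_(i <- gsupp endo_gr f) d_comm i (gcomp endo_gr f i) \in endo_pred.
Proof.
apply/is_endo_in/is_endo_sum => i.
exact/is_endo_deg/d_comm_deg/(gcomp_deg endo_gr).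
Qed.

(* d_End, extended additively from homogeneous endomorphisms: see dEndE. *)
Definition dEnd (f : endo) : endo := Endo (dEnd_subproof f).

Lemma dEndE i (f : endo) : endo_deg i f -> val (dEnd f) = d_comm i f.
Proof.
move=> hf; apply: (@gsum_homog _ _ endo_gr _ (fun i (g : endo) => d_comm i g)) => //.
move=> j; apply/funext => m; rewrite /d_comm !fctE.
rewrite [X in dgm_d M X](_ : _ = 0) // [X in _ *: X](_ : _ = 0) //.
by rewrite linear0 scaler0 subr0.
Qed.

End Endo.

(* -------------------------------------------------------------------- *)
(* The polynomial ring B[eps], with eps central.  {poly B} is not available
   because End(M) is the zero ring when M = 0. *)
Definition epoly (B : pzRingType) : Type := {malg B[nat]}.

HB.instance Definition _ (B : pzRingType) := GRing.Zmodule.on (epoly B).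

Section EpsPoly.
Variable B : pzRingType.
Implicit Types p q : epoly B.

Definition epoly1 : epoly B := << 1 *g 0%N >>.

Definition epolyM p q : epoly B :=
  \sum_(i <- msupp p) \sum_(j <- msupp q) << p@_i * q@_j *g (i + j)%N >>.

Lemma epolyMw (d e : {fset nat}) p q : msupp p `<=` d -> msupp q `<=` e ->
  epolyM p q = \sum_(i <- d) \sum_(j <- e) << p@_i * q@_j *g (i + j)%N >>.
Proof.
move=> le_d le_e; rewrite /epolyM (big_fset_incl _ le_d) /=.
  apply/eq_bigr=> i _; apply/big_fset_incl => // j _ /mcoeff_outdom ->.
  by rewrite mulr0 monalgU0.
move=> i _ /mcoeff_outdom pi.
by rewrite big1 // => j _; rewrite pi mul0r monalgU0.
Qed.

Lemma epolyUU (x y : B) i j :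
  epolyM << x *g i >> << y *g j >> = << x * y *g (i + j)%N >>.
Proof.
by rewrite (epolyMw (@msuppU_le _ _ _ _) (@msuppU_le _ _ _ _)) !big_seq_fset1 !mcoeffUU.
Qed.

Fact epolyDM : left_distributive epolyM +%R.
Proof.
move=> p q r; rewrite (epolyMw (msuppD_le p q) (fsubset_refl _)).
rewrite (epolyMw (fsubsetUl _ (msupp q)) (fsubset_refl (msupp r))).
rewrite (epolyMw (fsubsetUr (msupp p) _) (fsubset_refl (msupp r))).
rewrite -big_split /=; apply/eq_bigr=> i _.
rewrite -big_split /=; apply/eq_bigr=> j _.
by rewrite mcoeffD mulrDl monalgUD.
Qed.

Fact epolyMD : right_distributive epolyM +%R.
Proof.
move=> r p q; rewrite (epolyMw (fsubset_refl _) (msuppD_le p q)).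
rewrite (epolyMw (fsubset_refl (msupp r)) (fsubsetUl _ (msupp q))).
rewrite (epolyMw (fsubset_refl (msupp r)) (fsubsetUr (msupp p) _)).
rewrite -big_split /=; apply/eq_bigr=> i _.
rewrite -big_split /=; apply/eq_bigr=> j _.
by rewrite mcoeffD mulrDr monalgUD.
Qed.

Let epoly0M p : epolyM 0 p = 0.
Proof. by rewrite /epolyM msupp0 big_seq_fset0. Qed.

Let epolyM0 p : epolyM p 0 = 0.
Proof. by rewrite /epolyM big1 // => i _; rewrite msupp0 big_seq_fset0. Qed.

Let suml (I : Type) (r : seq I) (F : I -> epoly B) q :
  epolyM (\sum_(i <- r) F i) q = \sum_(i <- r) epolyM (F i) q.
Proof. exact: (big_morph (epolyM^~ q) (fun _ _ => epolyDM _ _ _) (epoly0M q)). Qed.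

Let sumr (I : Type) (r : seq I) (F : I -> epoly B) p :
  epolyM p (\sum_(i <- r) F i) = \sum_(i <- r) epolyM p (F i).
Proof. exact: (big_morph (epolyM p) (fun _ _ => epolyMD _ _ _) (epolyM0 p)). Qed.

Fact epoly1M : left_id epoly1 epolyM.
Proof.
move=> p; rewrite [in LHS](monalgE p) sumr [RHS]monalgE.
by apply/eq_bigr => i _; rewrite epolyUU mul1r.
Qed.

Fact epolyM1 : right_id epoly1 epolyM.
Proof.
move=> p; rewrite [in LHS](monalgE p) suml [RHS]monalgE.
by apply/eq_bigr => i _; rewrite epolyUU mulr1 addn0.
Qed.

Fact epolyA : associative epolyM.
Proof.
have l1 p q : epolyM p q = \sum_(i <- msupp p) epolyM << p@_i *g i >> q.
  by rewrite -suml -monalgE.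
have l2 p q : epolyM p q = \sum_(i <- msupp q) epolyM p << q@_i *g i >>.
  by rewrite -sumr -monalgE.
move=> p q r; rewrite l1 (l1 p q) [RHS]suml; apply: eq_bigr => i _.
rewrite (l1 q r) [LHS]sumr (l2 _ q) [RHS]suml; apply: eq_bigr => j _.
rewrite (l2 _ r) [LHS]sumr [RHS]l2; apply: eq_bigr => l _.
by rewrite !epolyUU mulrA addnA.
Qed.

HB.instance Definition _ := GRing.Zmodule_isPzRing.Build (epoly B)
  epolyA epoly1M epolyM1 epolyDM epolyMD.

End EpsPoly.

(* d and I are extended to B[eps] coefficientwise; both are meant to be
   additive. *)
Definition epoly_map (B : pzRingType) (d : B -> B) (p : epoly B) : epoly B :=
  \sum_(n <- msupp p) << d p@_n *g n >>.

Definition epoly_int (k : comUnitRingType) (B : pzRingType) (I : B -> k)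
  (p : epoly B) : {poly k} := \sum_(n <- msupp p) I p@_n *: 'X^n.

(* -------------------------------------------------------------------- *)
(* The free algebra on two letters: false stands for a and true for d(a). *)
Definition free2 (k : comUnitRingType) := {malg k[{fmonom bool}]}.

Section ChernSimons.
Variable k : comUnitRingType.

Definition free_a : free2 k := << fmu false >>.
Definition free_da : free2 k := << fmu true >>.

Definition wordlen (p : free2 k) : free2 k :=
  \sum_(w <- msupp p) << (fdeg w)%:R * p@_w *g w >>.

(* Only meaningful when the lengths of the words of p are invertible in k. *)
Definition wordlen_inv (p : free2 k) : free2 k :=
  \sum_(w <- msupp p) << (fdeg w)%:R^-1 * p@_w *g w >>.

Lemma wordlen_invK (p : free2 k) :
  (forall w, w \in msupp p -> (fdeg w)%:R \is a @GRing.unit k) ->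
  wordlen (wordlen_inv p) = p.
Proof.
have coef (c : {fmonom bool} -> k) (q : free2 k) w :
    (\sum_(v <- msupp q) << c v * q@_v *g v >>)@_w = c w * q@_w.
  rewrite [in RHS](monalgE q) !raddf_sum mulr_sumr; apply/eq_bigr=> v _ /=.
  by rewrite !mcoeffU; case: eqVneq => [->|_]; rewrite ?mulr1n // !mulr0n mulr0.
move=> hp; apply/malgP => w; rewrite !coef.
by case: msuppP => [/hp u|_]; rewrite ?mulr0 // mulVKr.
Qed.

(* The algebra map with a |-> x, d(a) |-> y, where B is a k-algebra through
   iota : k -> B. *)
Definition free_eval (B : pzRingType) (iota : k -> B) (x y : B) (p : free2 k) : B :=
  \sum_(w <- msupp p) iota p@_w * \prod_(c <- (w : seq bool)) (if c then y else x).

(* cs_{2,2K}(a), for a differential d on a k-algebra B and a functional I on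
   it with values in C. *)
Definition cs_gen (B C : pzRingType) (iota : k -> B) (d : B -> B) (I : B -> C)
    (K : nat) (a : B) : C :=
  (2 * K)%:R *
    I (free_eval iota a (d a)
         (wordlen_inv (free_a * (free_da + free_a ^+ 2) ^+ K))).

Variables (A : dga k) (M : dgm A).

Definition cs (I : endo M -> k) (K : nat) (a : endo M) : k :=
  @cs_gen (endo M) k (fun c => c *: (1 : endo M)) (@dEnd k A M) I K a.

(* The polynomial cs_{2,2K}(a + b eps), computed in End(M)[eps]. *)
Definition cs_poly (I : endo M -> k) (K : nat) (a b : endo M) : {poly k} :=
  @cs_gen (epoly (endo M)) {poly k} (fun c => << c *: (1 : endo M) *g 0%N >>)
    (epoly_map (@dEnd k A M)) (epoly_int I) K
    (<< a *g 0%N >> + << b *g 1%N >>).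

Definition cs_critical (I : endo M -> k) (K : nat) (a : endo M) : Prop :=
  forall b : endo M, endo_deg 1 b -> (cs_poly I K a b)`_1 = 0.

(* gs lists homogeneous endomorphisms with their degrees. *)
Definition cyclic_int (I : endo M -> k) : Prop :=
  forall (i : int) (f : endo M) (gs : seq (int * endo M)),
    endo_deg i f -> (forall g, g \in gs -> endo_deg g.1 g.2) ->
    I (f * \prod_(g <- gs) g.2) =
      (-1) ^ (i * \sum_(g <- gs) g.1) * I ((\prod_(g <- gs) g.2) * f).

End ChernSimons.

(* Main.v *)
Require Import Defs.
From HB Require Import structures.
From mathcomp Require Import all_boot all_order all_algebra finmap zify.
From mathcomp Require Import boolp functions monalg.

(* The sign in the cyclicity of I is trivial in the odd degree 2K + 1 and I
   vanishes in all other degrees, so I is a genuine trace.  Write W_n for the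
   coefficient of s^n in F^K, where F = d(a) + s a^2 and s is a central variable;
   the words of a W_n all have length K + 1 + n, so cs is 2K times the sum of the
   I (a W_n) / (K + 1 + n).  With the covariant derivative D = d + s [a, _] one
   has D F = 0 and D a = F + s dF/ds, while the variation of F along b is D b.
   Integrating by parts, the variation of I (a F^K) is I (b (F^K + K F^K + s dF^K/ds)),
   i.e. that of I (a W_n) is (K + 1 + n) I (b W_n).  The denominators cancel, the
   differential of cs at a is b |-> 2K I (b (d(a) + a^2)^K), and 2K is a unit. *)

Set Implicit Arguments.
Unset Strict Implicit.
Unset Printing Implicit Defensive.

Import GRing.Theory.

Local Open Scope ring_scope.

(** * Coefficients of powers of a linear polynomial *)

(* [wcoef u v K n] is the coefficient of [s ^ n] in [(u + s v) ^ K], with [s]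
   central, and [dwcoef u v u' v' K n] is its first variation. *)
Section WordCoefficients.
Variables (B : pzRingType) (u v u' v' : B).

Fixpoint wcoef (K n : nat) : B :=
  if K is K'.+1 then
    u * wcoef K' n + (if n is n'.+1 then v * wcoef K' n' else 0)
  else (n == 0%N)%:R.

Fixpoint dwcoef (K n : nat) : B :=
  if K is K'.+1 then
    u' * wcoef K' n + u * dwcoef K' n +
    (if n is n'.+1 then v' * wcoef K' n' + v * dwcoef K' n' else 0)
  else 0.

Lemma wcoefS K n : wcoef K.+1 n =
  u * wcoef K n + (if n is n'.+1 then v * wcoef K n' else 0).
Proof. by []. Qed.

Lemma dwcoefS K n : dwcoef K.+1 n = u' * wcoef K n + u * dwcoef K n +
  (if n is n'.+1 then v' * wcoef K n' + v * dwcoef K n' else 0).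
Proof. by []. Qed.

Lemma wcoef_gt K n : (K < n)%N -> wcoef K n = 0.
Proof.
elim: K n => [|K IHK] [|n] //; rewrite ltnS => ltKn.
by rewrite wcoefS !IHK ?mulr0 ?addr0 // ltnW.
Qed.

Lemma exprD_wcoef K : (u + v) ^+ K = \sum_(n < K.+1) wcoef K n.
Proof.
elim: K => [|K IHK]; first by rewrite big_ord1.
under [RHS]eq_bigr => n _ do rewrite wcoefS.
rewrite exprS {}IHK mulrDl big_split; congr (_ + _).
  by rewrite [RHS]big_ord_recr wcoef_gt // mulr0 /= addr0 mulr_sumr.
by rewrite [RHS]big_ord_recl /= add0r mulr_sumr.
Qed.

End WordCoefficients.

(** The recursion for [wcoef] makes sense over every ring, the zero ring included; over a nontrivial
    ring it can be handled as an honest polynomial coefficient. *)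
Lemma coef_linear_exp (R : nzRingType) (u v : R) K n :
  ((u%:P + 'X * v%:P) ^+ K)`_n = wcoef u v K n.
Proof.
elim: K n => [|K IHK] n; first by rewrite coef1.
rewrite exprS mulrDl coefD coefCM IHK -mulrA coefXM.
by rewrite wcoefS; case: n => [|n] //=; rewrite coefCM IHK.
Qed.

(** * Derivatives of powers in a noncommutative ring *)

Section NoncommutativeLeibniz.
Variable R : pzRingType.

(** The derivative of [F ^+ K] in the direction [h], which need not commute with [F]. *)
Definition sandwich (F h : R) K := \sum_(i < K) F ^+ i * h * F ^+ (K - i.+1).

Lemma sandwichS F h K : sandwich F h K.+1 = h * F ^+ K + F * sandwich F h K.
Proof.
rewrite /sandwich big_ord_recl mul1r subn1 mulr_sumr; congr (_ + _).
by apply: eq_bigr => i _; rewrite /= subSS exprS !mulrA.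
Qed.

Lemma sandwichD F h h' K : sandwich F (h + h') K = sandwich F h K + sandwich F h' K.
Proof. by rewrite -big_split; apply: eq_bigr => i _; rewrite mulrDr mulrDl. Qed.

(** Euler's identity: in the direction [F] all the summands coincide. *)
Lemma sandwich_self F K : sandwich F F K = F ^+ K *+ K.
Proof.
rewrite /sandwich (eq_bigr (fun=> F ^+ K)) => [|i _].
  by rewrite sumr_const card_ord.
by rewrite -exprSr -exprD subnKC.
Qed.

End NoncommutativeLeibniz.

Lemma deriv_exp_sandwich (R : nzRingType) (F : {poly R}) K :
  (F ^+ K)^`() = sandwich F F^`() K.
Proof.
elim: K => [|K IHK]; first by rewrite /sandwich big_ord0 -[_ ^+ 0]polyC1 derivC.
by rewrite exprS derivM IHK sandwichS.
Qed.

Lemma coef_sandwich_linear (R : nzRingType) (u v u' v' : R) K n :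
  (sandwich (u%:P + 'X * v%:P) (u'%:P + 'X * v'%:P) K)`_n = dwcoef u v u' v' K n.
Proof.
elim: K n => [|K IHK] n; first by rewrite /sandwich big_ord0 coef0.
rewrite dwcoefS sandwichS !mulrDl !coefD !coefCM coef_linear_exp IHK -!mulrA !coefXM.
rewrite addrACA; case: n => [|n] /=; first by rewrite addr0.
by rewrite !coefCM coef_linear_exp IHK.
Qed.

(** * First variation for a closed trace on a differential graded ring *)

Section FirstVariation.
Variables (R : nzRingType) (V : zmodType) (I : {additive R -> V}).
(** Additivity and the Leibniz rule are asked only of homogeneous elements. Everything formed from
    [a], [b] and [d] has nonnegative degree, so degrees are naturals. *)
Variables (d : R -> R) (deg : nat -> R -> Prop).
Hypothesis deg0 : forall i, deg i 0.
Hypothesis deg1 : deg 0 1.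
Hypothesis degD : forall i x y, deg i x -> deg i y -> deg i (x + y).
Hypothesis degM : forall i j x y, deg i x -> deg j y -> deg (i + j) (x * y).
Hypothesis deg_d : forall i x, deg i x -> deg i.+1 (d x).
Hypothesis dD : forall i x y, deg i x -> deg i y -> d (x + y) = d x + d y.
Hypothesis dM : forall i j x y, deg i x -> deg j y ->
  d (x * y) = d x * y + (-1) ^+ i * (x * d y).
Hypothesis IC : forall x y, I (x * y) = I (y * x).
Hypothesis Id : forall x, I (d x) = 0.

Let d0 : d 0 = 0.
Proof.
have := dD (deg0 0) (deg0 0); rewrite addr0 => /(congr1 (fun x => x - d 0)).
by rewrite addrK subrr => /esym.
Qed.

(** The two claims go together: using [dD] at each step requires the degree of the partial sum. *)
Let d_sum i n (F : 'I_n -> R) : (forall j, deg i (F j)) ->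
  deg i (\sum_(j < n) F j) /\ d (\sum_(j < n) F j) = \sum_(j < n) d (F j).
Proof.
elim: n F => [|n IHn] F hF; first by rewrite !big_ord0.
have [hS eS] := IHn _ (fun j => hF (lift ord0 j)).
by rewrite !big_ord_recl -eS; split; [apply: degD|apply: (dD (i := i))].
Qed.

(** The central variable ['X] gets degree 0 and is killed by [dp]; thus [dp] is a graded derivation
    and each [tau n] a closed trace. *)
Let pdeg i (p : {poly R}) := forall n, deg i p`_n.
Let dp (p : {poly R}) : {poly R} := map_poly d p.
Let tau n (p : {poly R}) : V := I p`_n.

Let coef_dp p n : (dp p)`_n = d p`_n.
Proof. exact: coef_map_id0. Qed.

Let pdegM i j p q : pdeg i p -> pdeg j q -> pdeg (i + j) (p * q).
Proof.
move=> hp hq n; rewrite coefM.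
by have [] := d_sum (fun l : 'I_n.+1 => degM (hp l) (hq (n - l)%N)).
Qed.

Let pdegC i x : deg i x -> pdeg i x%:P.
Proof. by move=> hx n; rewrite coefC; case: ifP. Qed.

Let dpC x : dp x%:P = (d x)%:P.
Proof. by apply/polyP=> n; rewrite coef_dp !coefC; case: ifP. Qed.

Let dpM i j p q : pdeg i p -> pdeg j q ->
  dp (p * q) = dp p * q + (-1) ^+ i * (p * dp q).
Proof.
move=> hp hq; apply/polyP=> n.
rewrite coef_dp coefM (d_sum (fun l : 'I_n.+1 => degM (hp l) (hq (n - l)%N))).2.
have -> : (-1) ^+ i * (p * dp q) = ((-1) ^+ i)%:P * (p * dp q).
  by rewrite rmorphXn rmorphN1.
rewrite coefD coefCM !coefM mulr_sumr -big_split /=; apply: eq_bigr => l _.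
by rewrite !coef_dp (dM (hp l) (hq _)).
Qed.

Let tauC n p q : tau n (p * q) = tau n (q * p).
Proof.
rewrite /tau coefM coefMr !raddf_sum; apply: eq_bigr => l _ /=.
by rewrite IC.
Qed.

Let tauD n : {morph tau n : p q / p + q}.
Proof. by move=> p q; rewrite /tau coefD raddfD. Qed.

Let tau_dp n p : tau n (dp p) = 0.
Proof. by rewrite /tau coef_dp Id. Qed.

Variables a b : R.
Hypotheses (ha : deg 1 a) (hb : deg 1 b) (dda : d (d a) = 0).

Let pa := a%:P.
Let pb := b%:P.
(** ['X * F] is the curvature of the connection [d + 'X a]. *)
Let F : {poly R} := (d a)%:P + 'X * (a ^+ 2)%:P.

Let cX (p : {poly R}) : 'X * p = p * 'X. Proof. exact/esym/commr_polyX. Qed.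

Let XC (p q : {poly R}) : p * ('X * q) = 'X * (p * q).
Proof. by rewrite mulrA -cX mulrA. Qed.

Let degF : pdeg 2 F.
Proof.
move=> n; rewrite coefD coefC coefXM coefC.
case: n => [|[|n]] /=; rewrite ?addr0 ?add0r //; first exact: deg_d.
exact: (degM ha ha).
Qed.

Let degFX i : pdeg (i * 2) (F ^+ i).
Proof.
elim: i => [|i IHi]; last by rewrite exprS; apply: (pdegM degF IHi).
by rewrite expr0 -polyC1; apply: pdegC.
Qed.

(** Bianchi identity: the covariant derivative of [F ^+ i] vanishes. It passes from [F] to its
    powers because [F] has even degree, so that no sign enters the Leibniz rule. *)
Let bianchi i : dp (F ^+ i) = 'X * (F ^+ i * pa - pa * F ^+ i).
Proof.
elim: i => [|i IHi].
  rewrite expr0 mul1r mulr1 subrr mulr0 -polyC1 dpC; congr (_%:P).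
  (* The Leibniz rule for 1 * 1 gives [d 1 = d 1 + d 1], hence [d 1 = 0]. *)
  have := dM deg1 deg1; rewrite expr0 !mul1r mulr1 => /(congr1 (fun x => x - d 1)).
  by rewrite addrK subrr => /esym.
have dF : dp F = 'X * (F * pa - pa * F).
  (* The cubic terms in [a] cancel in the commutator. *)
  have -> : F * pa - pa * F = (d a * a - a * d a)%:P.
    rewrite /F /pa mulrDl mulrDr opprD addrACA [_ * ('X * _)]mulrA -(cX a%:P).
    by rewrite -!mulrA -!polyCM -exprSr -exprS subrr addr0 -polyCB.
  apply/polyP => n; rewrite coef_dp coefD coefC !coefXM !coefC.
  case: n => [|[|n]] /=; rewrite ?addr0 ?add0r //.
  by rewrite (dM ha ha) expr1 mulN1r.
rewrite exprS (dpM degF (degFX i)) IHi dF sqrrN expr1n mul1r.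
rewrite [F * ('X * _)]mulrA -[F * 'X]cX -!mulrA -mulrDr; congr ('X * _).
by rewrite mulrBl mulrBr -!mulrA addrC addrA addrNK.
Qed.

(** The covariant derivative in odd degree, where the graded commutator with [a] is an
    anticommutator. *)
Let D (p : {poly R}) := dp p + 'X * (pa * p + p * pa).

(** Expand [dp] of [pa * F ^+ i * pb * F ^+ j], whose trace is 0. By [bianchi] the differentiated
    powers of [F] become commutators with ['X * pa], which complete [dp pa] and [dp pb] to [D pa]
    and [D pb]. *)
Let by_parts n i j :
  tau n (pa * (F ^+ i * D pb * F ^+ j)) = tau n (pb * (F ^+ j * D pa * F ^+ i)).
Proof.
have sgn l : (-1) ^+ (l * 2) = 1 :> {poly R} by rewrite mulnC exprM sqrrN !expr1n.
have dap : pdeg 1 pa by apply: pdegC.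
have dbp : pdeg 1 pb by apply: pdegC.
have dbF := pdegM dbp (degFX j).
have := tau_dp n (pa * (F ^+ i * (pb * F ^+ j))).
rewrite (dpM dap (pdegM (degFX i) dbF)) (dpM (degFX i) dbF).
rewrite (dpM dbp (degFX j)) !bianchi sgn expr1 !mulN1r mul1r.
rewrite [X in _ -> tau n X = _](_ : _ =
  pa * (F ^+ i * (dp pb * F ^+ j)) +
  'X * (pa * (F ^+ i * (pa * (pb * F ^+ j)))) +
  'X * (pa * (F ^+ i * (pb * (pa * F ^+ j))))); last first.
  by rewrite /D !(mulrDr, mulrDl) -!mulrA ?XC -?mulrA addrA.
rewrite [X in _ -> _ = tau n X](_ : _ =
  (pb * F ^+ j) * (dp pa * F ^+ i) +
  ('X * (pb * F ^+ j * pa)) * (pa * F ^+ i) +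
  ('X * (pb * F ^+ j)) * (pa * (pa * F ^+ i))); last first.
  by rewrite /D !(mulrDr, mulrDl) -!mulrA ?XC -?mulrA addrA.
rewrite !(mulrDr, mulrDl, mulrN, mulNr, opprD, opprK) -!mulrA ?XC.
(* Cyclic rotations bring the monomials of both expansions to common representatives. *)
have c1 : tau n (pb * (F ^+ j * (dp pa * F ^+ i))) =
    tau n (dp pa * (F ^+ i * (pb * F ^+ j))).
  by rewrite mulrA tauC -!mulrA.
have c2 : tau n ('X * (pb * (F ^+ j * (pa * (pa * F ^+ i))))) =
    tau n ('X * (pa * (pa * (F ^+ i * (pb * F ^+ j))))).
  by rewrite -!XC mulrA tauC -!mulrA !XC.
have c3 : tau n ('X * (pa * (F ^+ i * (pb * (F ^+ j * pa))))) =
    tau n ('X * (pa * (pa * (F ^+ i * (pb * F ^+ j))))).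
  by rewrite !mulrA tauC -!mulrA XC.
have tauN p : tau n (- p) = - tau n p by rewrite /tau coefN raddfN.
rewrite !tauD !tauN c1 c2 c3 => e; apply/esym/eqP; rewrite -subr_eq0 -[X in _ == X]e.
(* The six terms of [e] are the three of each side, in another order. *)
by rewrite !opprD; apply/eqP; rewrite [LHS](AC (3*3) (1*((5*2)*(4*(3*6))))%AC).
Qed.

Let sandwich_by_parts n K :
  tau n (pa * sandwich F (D pb) K) = tau n (pb * sandwich F (D pa) K).
Proof.
rewrite /sandwich !mulr_sumr /tau !coef_sum !raddf_sum /=.
(* Integration by parts exchanges the exponents on the two sides of the middle factor, so one sum is
   read backwards. *)
rewrite [RHS](reindex_inj rev_ord_inj); apply: eq_bigr => i _ /=.
by rewrite subnSK // subKn ?(ltnW (ltn_ord i)) //; apply: by_parts.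
Qed.

(** Only the K factors [F] are varied here, whence K + n; varying the leading [a] will contribute
    the remaining 1. *)
Lemma first_variation K n :
  I (a * dwcoef (d a) (a ^+ 2) (d b) (a * b + b * a) K n) =
  I (b * wcoef (d a) (a ^+ 2) K n) *+ (K + n).
Proof.
have DC x : D x%:P = (d x)%:P + 'X * (a * x + x * a)%:P.
  by rewrite /D dpC /pa -!polyCM -polyCD.
(* The anticommutator of [a] with itself is twice [a ^+ 2]: one copy completes [d a] to [F], the
   other is the derivative of [F]. *)
have Da : D pa = F + 'X * (a ^+ 2)%:P by rewrite DC polyCD mulrDr addrA.
have dF : F^`() = (a ^+ 2)%:P.
  by rewrite derivD derivC add0r derivM derivX mul1r derivC mulr0 addr0.
have sX h : sandwich F ('X * h) K = 'X * sandwich F h K.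
  rewrite /sandwich mulr_sumr; apply: eq_bigr => i _.
  by rewrite XC -[LHS]mulrA.
have := sandwich_by_parts n K.
rewrite /tau !coefCM DC coef_sandwich_linear => e; rewrite [LHS]e {e}.
rewrite Da sandwichD sandwich_self sX -dF -deriv_exp_sandwich.
rewrite coefD coefMn coef_linear_exp coefXM coef_deriv coef_linear_exp.
rewrite mulrnDr -raddfMn -raddfMn -raddfD -!mulrnAr -mulrDr.
by case: n => [|n] //=; rewrite mulr0n.
Qed.

End FirstVariation.

(** * The differential graded ring structure of End(M) *)

Section EndoDga.
Variables (k : comUnitRingType) (A : dga k) (M : dgm A).
Implicit Types f g : endo M.

Lemma endo_ext f g : (forall m, f m = g m) -> f = g.
Proof. by move=> e; apply/val_inj/funext. Qed.

Lemma endo_funD f g m : (f + g) m = f m + g m. Proof. by []. Qed.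
Lemma endo_funM f g m : (f * g) m = f (g m). Proof. by []. Qed.

Lemma endo_fun_linear f : linear f.
Proof. exact/is_endo_linear/endoP. Qed.

Lemma dEnd_fun i f m : endo_deg i f ->
  dEnd f m = dgm_d M (f m) - (-1) ^ i *: f (dgm_d M m).
Proof. by move=> hf; rewrite -[LHS]/(val (dEnd f) m) (dEndE hf). Qed.

Lemma dEnd_deg i f : endo_deg i f -> endo_deg (i + 1) (dEnd f).
Proof.
move=> hf; rewrite -[endo_fun _]/(val (dEnd f)) (dEndE hf).
exact: d_comm_deg.
Qed.

Lemma dEndD i f g : endo_deg i f -> endo_deg i g -> dEnd (f + g) = dEnd f + dEnd g.
Proof.
move=> hf hg; apply: endo_ext => m.
have hfg : endo_deg i (f + g : endo M) := endo_degD hf hg.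
rewrite endo_funD (dEnd_fun _ hfg) (dEnd_fun _ hf) (dEnd_fun _ hg).
by rewrite !endo_funD linearD scalerDr opprD addrACA.
Qed.

Lemma dEndM i j f g : endo_deg i%:Z f -> endo_deg j g ->
  dEnd (f * g) = dEnd f * g + (-1) ^+ i * (f * dEnd g).
Proof.
move=> hf hg; apply: endo_ext => m.
have um1 : (-1 : k) \is a GRing.unit by rewrite unitrN unitr1.
have -> : (-1) ^+ i * (f * dEnd g) = (-1) ^+ i *: (f * dEnd g).
  by rewrite -signr_odd -[in RHS]signr_odd !mulr_sign scaler_sign.
have hfg : endo_deg (i%:Z + j) (f * g : endo M) := endo_degM hf hg.
rewrite endo_funD endo_funM (dEnd_fun _ hfg) (dEnd_fun _ hf).
rewrite -[((_ *: _) : endo M) m]/(_ *: (f (dEnd g m))) (dEnd_fun _ hg).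
rewrite (linB (endo_fun_linear f)) (linZ (endo_fun_linear f)) !endo_funM.
by rewrite scalerBr scalerA exprnP -(exprzDr um1) addrA subrK.
Qed.

(** The outer terms vanish as [dgm_d] squares to 0; the mixed ones carry the signs of degrees i and
    i + 1 and cancel. *)
Lemma dEnd_dEnd i f : endo_deg i%:Z f -> dEnd (dEnd f) = 0.
Proof.
move=> hf; apply: endo_ext => m.
rewrite (dEnd_fun _ (dEnd_deg hf)) !(dEnd_fun _ hf) !dgm_dd linearB linearZ /=.
rewrite dgm_dd (lin0 (endo_fun_linear f)) scaler0 subr0 add0r.
by rewrite -[_ + 1]/((i + 1)%N%:Z) -!exprnP addn1 exprS mulN1r scaleNr opprK addNr.
Qed.

End EndoDga.

(** * From graded cyclicity to a trace *)

Lemma sign_complementary (R : unitRingType) (K : nat) (i j : int) :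
  i + j = (2 * K + 1)%:Z -> (-1 : R) ^ (i * j) = 1.
Proof.
move=> e; have jE : j = (2 * K + 1)%:Z - i by rewrite -e addrC addKr.
have sq (l : int) : (-1 : R) ^ (2 * l) = 1.
  by rewrite -exprz_exp -exprnP sqrrN expr1n exp1rz.
(* The sum of [i] and [j] is odd, so one of them is even and so is their product. *)
have [m [ -> | hm]] : exists m : int, i = 2 * m \/ i = 2 * m + 1.
  exists (i %/ 2)%Z; have := divz_eq i 2; rewrite mulrC.
  have := @modz_ge0 i 2 isT; have := @ltz_pmod i 2 isT.
  by case: (i %% 2)%Z => [[|[|n]]|n] // _ _; rewrite ?addr0; [left|right].
- by rewrite -mulrA sq.
- have -> : j = 2 * (K%:Z - m).
    by rewrite jE hm mulrBr PoszD PoszM opprD addrACA subrr addr0.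
  by rewrite mulrCA sq.
Qed.

Section CyclicTrace.
Variables (k : comUnitRingType) (A : dga k) (M : dgm A) (I : {scalar endo M}).
Variable K : nat.
Hypothesis hdeg : forall (i : int) (f : endo M),
  endo_deg i f -> i <> (2 * K + 1)%:Z -> I f = 0.

Lemma cyclic_intC : cyclic_int I -> forall f g, I (f * g) = I (g * f).
Proof.
move=> hcyc f g.
have homog i j (x y : endo M) : endo_deg i x -> endo_deg j y -> I (x * y) = I (y * x).
  move=> hx hy; have [ij|/eqP ij] := eqVneq (i + j) (2 * K + 1)%:Z; last first.
    have hxy : endo_deg (i + j) (x * y : endo M) := endo_degM hx hy.
    have hyx : endo_deg (j + i) (y * x : endo M) := endo_degM hy hx.
    by rewrite (hdeg hxy ij) (hdeg hyx) // addrC.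
  have := hcyc i x [:: (j, y)] hx; rewrite !big_seq1 (sign_complementary _ ij) mul1r.
  by apply=> l; rewrite inE => /eqP ->.
(* Biadditivity reduces the claim to homogeneous components. *)
rewrite (gcompE (endo_gr M) f) (gcompE (endo_gr M) g).
rewrite mulr_suml !raddf_sum mulr_sumr raddf_sum; apply: eq_bigr => i _ /=.
rewrite mulr_sumr mulr_suml !raddf_sum; apply: eq_bigr => j _ /=.
exact: homog (gcomp_deg (endo_gr M) _ _) (gcomp_deg (endo_gr M) _ _).
Qed.

End CyclicTrace.

(** * Coefficients of polynomials in eps *)

Lemma msupp_pick (T : choiceType) (B C : zmodType) (G : T -> B -> C)
    (p : {malg B[T]}) (m : T) :
  (forall i, G i 0 = 0) -> \sum_(i <- msupp p) G i p@_i *+ (i == m) = G m p@_m.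
Proof.
move=> G0; rewrite (big_fset_incl _ (fsubsetUl (msupp p) [fset m]%fset)) /=; last first.
  by move=> i _ /mcoeff_outdom ->; rewrite G0 mul0rn.
rewrite (big_fsetD1 m) /= ?inE ?eqxx ?orbT // big1_fset ?addr0 // => i.
by rewrite !inE => /andP[/negbTE ->].
Qed.

Section EpsCoefficients.
Variable B : pzRingType.
Implicit Types p q U V : epoly B.

Lemma epolyM_coefE p q n : (p * q)@_n =
  \sum_(i <- msupp p) \sum_(j <- msupp q) p@_i * q@_j *+ ((i + j)%N == n).
Proof.
rewrite raddf_sum; apply: eq_bigr => i _; rewrite raddf_sum.
by apply: eq_bigr => j _; rewrite /= mcoeffU.
Qed.

Lemma epolyUM_coef (x : B) q n : ((<< x *g 0%N >> : epoly B) * q)@_n = x * q@_n.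
Proof.
rewrite [_ * _](epolyMw (msuppU_le (x := x)) (fsubset_refl (msupp q))).
rewrite big_seq_fset1 raddf_sum.
rewrite -(msupp_pick (G := fun _ c => x * c)) => [|_]; last exact: mulr0.
by apply: eq_bigr => i _; rewrite /= mcoeffU mcoeffUU.
Qed.

Lemma epolyMU_coef (x : B) p n : (p * (<< x *g 0%N >> : epoly B))@_n = p@_n * x.
Proof.
rewrite [_ * _](epolyMw (fsubset_refl (msupp p)) (msuppU_le (x := x))).
rewrite raddf_sum -(msupp_pick (G := fun _ c => c * x)) => [|_]; last exact: mul0r.
by apply: eq_bigr => i _; rewrite big_seq_fset1 /= mcoeffU mcoeffUU addn0.
Qed.

(** With [epolyM_coef1], this describes multiplication modulo eps^2. *)
Lemma epolyM_coef0 p q : (p * q)@_0%N = p@_0%N * q@_0%N.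
Proof.
rewrite epolyM_coefE -[RHS](msupp_pick (G := fun _ x => x * q@_0%N)) => [|_];
  last exact: mul0r.
apply: eq_bigr => i _.
rewrite -(msupp_pick (G := fun _ x => p@_i * x)) => [|_]; last exact: mulr0.
rewrite -sumrMnl; apply: eq_bigr => j _.
by rewrite addn_eq0 andbC -mulnb mulrnA.
Qed.

Lemma epolyM_coef1 p q :
  (p * q)@_1%N = p@_0%N * q@_1%N + p@_1%N * q@_0%N.
Proof.
rewrite epolyM_coefE.
rewrite -[p@_0%N * _](msupp_pick (G := fun _ x => x * q@_1%N)) => [|_]; last exact: mul0r.
rewrite -[p@_1%N * _](msupp_pick (G := fun _ x => x * q@_0%N)) => [|_]; last exact: mul0r.
rewrite -big_split; apply: eq_bigr => i _ /=.
rewrite -[p@_i * q@_1%N](msupp_pick (G := fun _ x => p@_i * x)) => [|_]; last exact: mulr0.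
rewrite -[p@_i * q@_0%N](msupp_pick (G := fun _ x => p@_i * x)) => [|_]; last exact: mulr0.
rewrite -!sumrMnl -big_split; apply: eq_bigr => j _ /=.
rewrite -!mulrnA -mulrnDr; congr (_ *+ _).
by case: i j => [|[|i]] [|[|j]].
Qed.

Lemma epoly_map_coef (d : B -> B) p n : d 0 = 0 -> (epoly_map d p)@_n = d p@_n.
Proof.
move=> d0; rewrite raddf_sum -[RHS](msupp_pick (G := fun _ => d)) //.
by apply: eq_bigr => i _; rewrite /= mcoeffU.
Qed.

Lemma epoly_int_coef (k : comUnitRingType) (I : B -> k) p n :
  I 0 = 0 -> (epoly_int I p)`_n = I p@_n.
Proof.
move=> I0; rewrite coef_sum -[RHS](msupp_pick (G := fun _ => I)) //.
by apply: eq_bigr => i _; rewrite coefZ coefXn eq_sym mulr_natr.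
Qed.

(** The coefficient of eps obeys the product rule, which is the recursion of [dwcoef]. The two
    equations are paired to serve as one rewrite rule. *)
Lemma wcoef_coef U V K n :
  ((wcoef U V K n)@_0%N = wcoef U@_0%N V@_0%N K n) *
  ((wcoef U V K n)@_1%N = dwcoef U@_0%N V@_0%N U@_1%N V@_1%N K n).
Proof.
elim: K n => [|K IHK] n.
  have c1 m : (1 : epoly B)@_m = (m == 0%N)%:R.
    by rewrite [LHS]mcoeffU eq_sym.
  by case: n => [|n]; split; rewrite /= ?mcoeff0 ?c1.
split; rewrite ?wcoefS ?dwcoefS mcoeffD.
  by rewrite epolyM_coef0 IHK; case: n => [|n]; rewrite ?mcoeff0 // epolyM_coef0 IHK.
rewrite epolyM_coef1 !IHK [X in X + _]addrC; congr (_ + _).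
by case: n => [|n]; rewrite ?mcoeff0 // epolyM_coef1 !IHK addrC.
Qed.

End EpsCoefficients.

(** * Word length and evaluation in the free algebra *)

Section FreeAlgebra.
Variable k : comUnitRingType.
Implicit Types (p q : free2 k) (l : bool).

Definition fhomog n p := forall w, w \in msupp p -> fdeg w = n.

Lemma fhomog0 n : fhomog n 0.
Proof. by move=> w; rewrite msupp0 in_fset0. Qed.

Lemma fhomogD n p q : fhomog n p -> fhomog n q -> fhomog n (p + q).
Proof.
by move=> hp hq w /(fsubsetP (msuppD_le _ _)); rewrite inE => /orP[/hp|/hq].
Qed.

Lemma fhomogM m n p q : fhomog m p -> fhomog n q -> fhomog (m + n) (p * q).
Proof.
by move=> hp hq w /msuppM_le[v [v' [/hp <- /hq <- ->]]]; rewrite fdegM.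
Qed.

Lemma fhomog_letter l : fhomog 1 (<< fmu l >> : free2 k).
Proof. by move=> w; rewrite msuppU1 in_fset1 => /eqP ->; rewrite fdegU. Qed.

(** Of the K factors, n are [a ^+ 2], of length 2, and the others [d(a)], of length 1. *)
Lemma fhomog_wcoef K n :
  fhomog (K + n) (wcoef (free_da k) (free_a k ^+ 2) K n).
Proof.
elim: K n => [|K IHK] n.
  case: n => [|n]; last exact: fhomog0.
  by move=> w; rewrite -[wcoef _ _ _ _]/1 msuppU1 in_fset1 => /eqP ->; rewrite fdeg1.
rewrite wcoefS; apply: fhomogD.
  by rewrite addSn -add1n; apply: fhomogM (@fhomog_letter true) (IHK n).
case: n => [|n]; first exact: fhomog0.
rewrite addSn addnS -addn2 addnC; apply: fhomogM (IHK n).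
exact: (fhomogM (@fhomog_letter false) (@fhomog_letter false)).
Qed.

Lemma wordlen_inv_sum n (m : 'I_n -> nat) (F : 'I_n -> free2 k) :
  (forall i, fhomog (m i) (F i)) ->
  wordlen_inv (\sum_i F i) = \sum_i (m i)%:R^-1 *: F i.
Proof.
move=> hF; apply/malgP => w; rewrite !raddf_sum /=.
under eq_bigr => v _ do rewrite mcoeffU.
rewrite (msupp_pick (G := fun v c => (fdeg v)%:R^-1 * c)) => [|v]; last exact: mulr0.
rewrite raddf_sum mulr_sumr; apply: eq_bigr => i _ /=; rewrite mcoeffZ.
by case: msuppP => [/hF -> //|_]; rewrite !mulr0.
Qed.

Section Evaluation.
Variables (B : pzRingType) (iota : k -> B) (x y : B).
Hypothesis iotaD : {morph iota : c c' / c + c'}.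
Hypothesis iotaM : {morph iota : c c' / c * c'}.
Hypothesis iota1 : iota 1 = 1.
Hypothesis iotaC : forall c z, iota c * z = z * iota c.

Local Notation ev := (free_eval iota x y).
Let letter l := if l then y else x.
Let word (w : {fmonom bool}) := \prod_(l <- (w : seq bool)) letter l.

Let iota0 : iota 0 = 0.
Proof.
have := iotaD 0 0; rewrite addr0 => /(congr1 (fun z => z - iota 0)).
by rewrite addrK subrr => /esym.
Qed.

Lemma free_evalEw (d : {fset {fmonom bool}}) p :
  (msupp p `<=` d)%fset -> ev p = \sum_(w <- d) iota p@_w * word w.
Proof.
move=> sd; rewrite /free_eval (big_fset_incl _ sd) // => w _ /mcoeff_outdom ->.
by rewrite iota0 mul0r.
Qed.

Lemma free_evalD : {morph ev : p q / p + q}.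
Proof.
move=> p q; rewrite (free_evalEw (msuppD_le p q)).
rewrite (free_evalEw (fsubsetUl _ (msupp q))) (free_evalEw (fsubsetUr (msupp p) _)).
by rewrite -big_split; apply: eq_bigr => w _; rewrite /= mcoeffD iotaD mulrDl.
Qed.

Lemma free_eval0 : ev 0 = 0.
Proof. by rewrite /free_eval msupp0 big_seq_fset0. Qed.

Lemma free_eval_sum (J : Type) (r : seq J) (F : J -> free2 k) :
  ev (\sum_(j <- r) F j) = \sum_(j <- r) ev (F j).
Proof. exact: (big_morph _ free_evalD free_eval0). Qed.

Lemma free_evalU c w : ev << c *g w >> = iota c * word w.
Proof. by rewrite (free_evalEw msuppU_le) big_seq_fset1 mcoeffUU. Qed.

Lemma free_evalZ c p : ev (c *: p) = iota c * ev p.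
Proof.
rewrite (free_evalEw (msuppZ_le c p)) mulr_sumr; apply: eq_bigr => w _.
by rewrite mcoeffZ iotaM mulrA.
Qed.

Lemma free_eval1 : ev 1 = 1.
Proof. by rewrite [LHS]free_evalU iota1 mul1r /word fm1 big_nil. Qed.

(** Multiplying by a letter prepends it to every word, and the central coefficients move past it;
    [wcoef] is built by such steps. *)
Lemma free_eval_letterM l p : ev (<< fmu l >> * p) = letter l * ev p.
Proof.
have -> : << fmu l >> * p = \sum_(w <- msupp p) << p@_w *g mmul (fmu l) w >>.
  rewrite (malgMEw (msuppU_le (x := 1)) (fsubset_refl _)) big_seq_fset1.
  by apply: eq_bigr => w _; rewrite mcoeffUU mul1r.
rewrite free_eval_sum mulr_sumr; apply: eq_bigr => w _.
by rewrite free_evalU /word fmM fmU big_cons mulrA iotaC -mulrA.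
Qed.

Lemma free_eval_wcoef K n :
  ev (wcoef (free_da k) (free_a k ^+ 2) K n) = wcoef y (x ^+ 2) K n.
Proof.
elim: K n => [|K IHK] n.
  by case: n => [|n]; [apply: free_eval1|apply: free_eval0].
rewrite !wcoefS free_evalD free_eval_letterM IHK; congr (_ + _).
case: n => [|n]; first exact: free_eval0.
by rewrite !expr2 -!mulrA !free_eval_letterM IHK.
Qed.

Lemma free_eval_chern_simons K :
  ev (wordlen_inv (free_a k * (free_da k + free_a k ^+ 2) ^+ K)) =
  \sum_(n < K.+1) iota (K + n).+1%:R^-1 * (x * wcoef y (x ^+ 2) K n).
Proof.
rewrite exprD_wcoef mulr_sumr (wordlen_inv_sum (m := fun n => (K + n).+1)) => [|n].
  rewrite free_eval_sum; apply: eq_bigr => n _.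
  by rewrite free_evalZ free_eval_letterM free_eval_wcoef.
(* The leading [a] adds 1 to the length K + n. *)
by rewrite -add1n; apply: fhomogM (@fhomog_letter false) (@fhomog_wcoef K n).
Qed.

End Evaluation.
End FreeAlgebra.

(** * The derivative of the Chern-Simons functional and its zeros *)

Section CriticalPoints.
Variables (k : comUnitRingType) (A : dga k) (M : dgm A) (I : {scalar endo M}).
Implicit Types f g : endo M.

Lemma endo_scalerAl (c : k) f g : (c *: f) * g = c *: (f * g).
Proof. exact: val_inj. Qed.

Lemma endo_scalerAr (c : k) f g : f * (c *: g) = c *: (f * g).
Proof. by apply: endo_ext => m; apply: linZ (endo_fun_linear f) _ _. Qed.

Lemma dEnd0 : dEnd (0 : endo M) = 0.
Proof.
have h0 : endo_deg 0 (0 : endo M) := endo_deg0 M 0.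
apply/(addIr (dEnd (0 : endo M))); rewrite add0r -(dEndD h0 h0).
by rewrite addr0.
Qed.

Hypothesis hI : forall f g, I (f * g) = I (g * f).
Hypothesis hd : forall f, I (dEnd f) = 0.
Variables a b : endo M.
Hypotheses (ha : endo_deg 1 a) (hb : endo_deg 1 b).

Lemma endo_first_variation K n :
  I (a * dwcoef (dEnd a) (a ^+ 2) (dEnd b) (a * b + b * a) K n) =
  I (b * wcoef (dEnd a) (a ^+ 2) K n) *+ (K + n).
Proof.
(* {poly _} is only available over a nontrivial ring. *)
have [e10|n10] := eqVneq (1 : endo M) 0.
  have z f : f = 0 by rewrite -[f]mul1r e10 mul0r.
  by rewrite (z (a * _)) (z (b * _)) !linear0 mul0rn.
pose R : nzRingType := HB.pack (endo M)
  (GRing.PzSemiRing_isNonZero.Build (endo M) n10).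
pose J : {additive R -> k} := I.
apply: (@first_variation R k J (@dEnd k A M)
  (fun n (f : endo M) => endo_deg n%:Z f)) => //.
- by move=> i; apply: endo_deg0.
- exact: endo_deg1.
- by move=> i f g; apply: endo_degD.
- by move=> i j f g; apply: endo_degM.
- by move=> i f hf; rewrite -addn1; apply: (dEnd_deg hf).
- by move=> i f g; apply: dEndD.
- by move=> i j f g; apply: dEndM.
- exact: (@dEnd_dEnd _ _ _ 1).
Qed.

(** For each n, varying the leading [a] and varying the other factors give together K + n + 1 times
    the trace of [b * wcoef _ _ K n]; this factor cancels the inverse word length, and the sum over
    n is the K-th power. *)
Lemma cs_poly_coef1 K :
  (forall n : nat, (K + 1 <= n <= 2 * K + 1)%N -> (n%:R : k) \is a GRing.unit) ->
  (cs_poly I K a b)`_1 = (2 * K)%:R * I (b * (dEnd a + a ^+ 2) ^+ K).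
Proof.
have coefnM m (p : {poly k}) : (m%:R * p)`_1 = m%:R * p`_1.
  by rewrite mulr_natl coefMn mulr_natl.
move=> hk; rewrite /cs_poly /cs_gen coefnM; congr (_ * _).
rewrite epoly_int_coef ?linear0 //.
set x : epoly (endo M) := _ + _.
set y := epoly_map _ x.
pose iota (c : k) : epoly (endo M) := << c *: (1 : endo M) *g 0%N >>.
have x0 : x@_0%N = a by rewrite mcoeffD !mcoeffU addr0.
have x1 : x@_1%N = b by rewrite mcoeffD !mcoeffU add0r.
have y0 : y@_0%N = dEnd a by rewrite (epoly_map_coef _ _ dEnd0) x0.
have y1 : y@_1%N = dEnd b by rewrite (epoly_map_coef _ _ dEnd0) x1.
have iotaM_coef c z n : (iota c * z)@_n = c *: z@_n.
  by rewrite epolyUM_coef endo_scalerAl mul1r.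
rewrite (free_eval_chern_simons (iota := iota)) => [|c c'|c c'||c z]; first last.
- by apply/malgP => n; rewrite iotaM_coef epolyMU_coef endo_scalerAr mulr1.
- by rewrite /iota scale1r.
- apply/malgP => n; rewrite iotaM_coef !mcoeffU.
  by case: eqP => _; rewrite ?mulr0n ?scaler0 // scalerA.
- by rewrite /iota scalerDl monalgUD.
rewrite raddf_sum linear_sum (exprD_wcoef (dEnd a)) mulr_sumr linear_sum.
apply: eq_bigr => n _ /=.
rewrite iotaM_coef epolyM_coef1 !wcoef_coef expr2 epolyM_coef0 epolyM_coef1.
rewrite x0 x1 y0 y1 linearZ linearD endo_first_variation /= -mulrSr.
(* Since n is at most K, the length K + n + 1 lies in the range of [hk]. *)
rewrite -[X in _ * X]mulr_natl mulKr //; apply: hk; have := ltn_ord n; lia.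
Qed.

End CriticalPoints.

Theorem theorem22 (K : nat) (hK : (1 <= K)%N) (k : comUnitRingType)
  (hk : forall n : nat, (K + 1 <= n <= 2 * K + 1)%N -> (n%:R : k) \is a GRing.unit)
  (A : dga k) (M : dgm A) (I : {scalar endo M})
  (hdeg : forall (i : int) (f : endo M),
     endo_deg i f -> i <> (2 * K + 1)%:Z -> I f = 0)
  (hnondeg : forall g : endo M, (forall f : endo M, I (f * g) = 0) -> g = 0)
  (hd : forall f : endo M, I (dEnd f) = 0)
  (hcyc : cyclic_int I)
  (a : endo M) (ha : endo_deg 1 a) :
  cs_critical I K a <-> (dEnd a + a ^+ 2) ^+ K = 0.
Proof.
have hI := cyclic_intC hdeg hcyc.
split=> [crit|F0 b hb]; last first.
  by rewrite (cs_poly_coef1 hI hd ha hb hk) F0 mulr0 linear0 mulr0.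
set F := dEnd a + a ^+ 2.
have degF : endo_deg 2 F := endo_degD (dEnd_deg ha) (endo_degM ha ha).
have degFK : endo_deg (2 * K)%:Z (F ^+ K).
  elim: (K) => [|n IHn]; first exact: endo_deg1.
  by rewrite exprS mulnS PoszD; apply: endo_degM.
(* As K is at least 1, 2K is at least K + 1. *)
have u2K : ((2 * K)%:R : k) \is a GRing.unit by apply: hk; lia.
(* Nondegeneracy is tested on the components of [f]: criticality settles degree 1, and in any other
   degree the product misses degree 2K + 1. *)
apply: hnondeg => f; rewrite (gcompE (endo_gr M) f) mulr_suml linear_sum big1 //= => i _.
have fi : endo_deg i (gcomp (endo_gr M) f i) := gcomp_deg (endo_gr M) f i.
have [i1|/eqP i1] := eqVneq i 1.
  rewrite i1 in fi *; have := crit _ fi.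
  by rewrite (cs_poly_coef1 hI hd ha fi hk) => /(canRL (mulKr u2K)) ->; rewrite mulr0.
have fiF : endo_deg (i + (2 * K)%:Z) (gcomp (endo_gr M) f i * F ^+ K : endo M) :=
  endo_degM fi degFK.
by apply: (hdeg _ _ fiF); lia.
Qed.
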